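(* Let $X$ be a space such that the set of isolated points of $X$ is dense in $X$. Then $X^\kappa$ is h-homogeneous for every infinite cardinal $\kappa$.
   Context: All spaces are assumed to be Tychonoff. Powers carry the product topology. A subset of a space is clopen if it is closed and open. A space is h-homogeneous if all of its non-empty clopen subsets (with the subspace topology) are homeomorphic to each other. *)

(* Defs.v *)
From mathcomp Require Import all_boot all_classical all_reals all_analysis.

Set Implicit Arguments.
Unset Strict Implicit.
Unset Printing Implicit Defensive.

Local Open Scope classical_set_scope.

(* [completely_regular_space] contains no separation axiom, hence the T1
   condition. It separates points from closed sets by [uniform_separator], which
   is separation by a continuous function into [0, 1] ([uniform_separatorP]). *)
Definition tychonoff_space (X : topologicalType) : Prop :=
  accessible_space X /\ completely_regular_space X.

Definition homeomorphic (S T : topologicalType) : Prop :=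
  exists (f : S -> T) (g : T -> S),
    [/\ cancel f g, cancel g f, continuous f & continuous g].

(* [set_type U] is the subtype of the points of [U]; its topology is the initial
   one for the inclusion, i.e. the subspace topology. *)
Definition h_homogeneous (T : topologicalType) : Prop :=
  forall U V : set T, clopen U -> clopen V -> U !=set0 -> V !=set0 ->
    homeomorphic (set_type U) (set_type V).

(* Main.v *)
Require Import Defs.
From HB Require Import structures.
From mathcomp Require Import all_boot all_classical all_reals all_analysis.

(* Let Y be the power, and d, e distinct isolated points of X (if there is only
   one, X is a point). Prepending d (resp. e) along an infinite sequence of
   coordinates is an embedding D (resp. E) of Y onto a clopen subset of Y.
   A non-empty clopen U contains a box fixing finitely many coordinates to
   isolated points; the box is clopen and homeomorphic to Y, so U is the disjoint
   sum of Y and a clopen V. Hilbert's hotel absorbs V: in Y, the copies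
   E V, D E V, D^2 E V, ... of V are moved one step further by D to make room for
   V in place of E V. The copies accumulate only at fixed points of D, which
   makes the shift and its inverse continuous. *)

Local Open Scope classical_set_scope.

(** * Homeomorphisms and maps glued along a set *)

Lemma homeomorphic_sym (S T : topologicalType) :
  homeomorphic S T -> homeomorphic T S.
Proof. by move=> [f [g [fK gK cf cg]]]; exists g, f. Qed.

Lemma homeomorphic_trans (S T W : topologicalType) :
  homeomorphic S T -> homeomorphic T W -> homeomorphic S W.
Proof.
move=> [f [g [fK gK cf cg]]] [f' [g' [fK' gK' cf' cg']]].
exists (f' \o f), (g \o g'); split; [exact: can_comp|exact: can_comp| |].
- by move=> x; apply: continuous_comp; [exact: cf|exact: cf'].
- by move=> x; apply: continuous_comp; [exact: cg'|exact: cg].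
Qed.

Lemma patch_in {A B : Type} (b : A -> B) (S : set A) (a : A -> B) x :
  S x -> patch b S a x = a x.
Proof. by move=> Sx; rewrite patchT ?inE. Qed.

Lemma patch_notin {A B : Type} (b : A -> B) (S : set A) (a : A -> B) x :
  ~ S x -> patch b S a x = b x.
Proof. by move=> Sx; rewrite patchC ?inE. Qed.

Lemma near_clopen {T : topologicalType} {S : set T} (x : T) :
  clopen S -> \forall y \near x, S y <-> S x.
Proof.
move=> [oS cS]; have [Sx|nSx] := pselect (S x).
  by near=> y; split=> // _; near: y; exact: open_nbhs_nbhs.
have oCS : open (~` S) by exact: closed_openC.
near=> y; split=> // Sy; have: (~` S) y by near: y; exact: open_nbhs_nbhs.
by [].
Unshelve. all: by end_near. Qed.

(* A function glued along [S] is continuous at a point where the two pieces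
   agree, even if that point lies on the boundary of [S]. *)
Lemma patch_continuous_at {T W : topologicalType} (S : set T) (a b : T -> W) x :
    {for x, continuous a} -> {for x, continuous b} ->
    (\forall y \near x, S y <-> S x) \/ a x = b x ->
  {for x, continuous (patch b S a)}.
Proof.
move=> ca cb [loc|ab].
  have [Sx|nSx] := pselect (S x).
    rewrite /prop_for /continuous_at patch_in//.
    apply: cvg_trans ca; apply: near_eq_cvg.
    by apply: filterS loc => y [_ /(_ Sx) Sy]; rewrite patch_in.
  rewrite /prop_for /continuous_at patch_notin//.
  apply: cvg_trans cb; apply: near_eq_cvg.
  by apply: filterS loc => y [/contra_not/(_ nSx) nSy _]; rewrite patch_notin.
have pE : patch b S a x = a x by rewrite /patch; case: ifP.
rewrite /prop_for /continuous_at pE => N aN.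
have aN' : nbhs x (a @^-1` N) by exact: ca.
have bN' : nbhs x (b @^-1` N) by apply: cb; rewrite -ab.
by apply: filterS2 aN' bN' => y ? ?; rewrite /= /patch; case: ifP.
Qed.

Lemma patch_continuous {T W : topologicalType} (S : set T) (a b : T -> W) :
  clopen S -> continuous a -> continuous b -> continuous (patch b S a).
Proof.
by move=> cS ca cb x; apply: patch_continuous_at; [exact: ca|exact: cb|
  left; exact: near_clopen].
Qed.

(** * Hilbert's hotel for two disjoint clopen copies of a space *)

Section hotel.
Context {Y : topologicalType} (D E T : Y -> Y).
Hypotheses (cD : continuous D) (cE : continuous E) (cT : continuous T).
Hypotheses (DK : cancel D T) (EK : cancel E T).
Hypotheses (clD : clopen (range D)) (clE : clopen (range E)).
Hypothesis DE : forall y y', D y <> E y'.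
(** The copies of [V] can accumulate only at points that [T] never takes out of [range D]; there [D]
    has to agree with the identity. *)
Hypothesis fixD : forall z, (forall n, range D (iter n T z)) -> D z = z.

Variable V : set Y.
Hypothesis clV : clopen V.

Let S := [set z | exists n y, V y /\ z = iter n D (E y)].

Let imageEE : E @` V = range E `&` T @^-1` V.
Proof.
apply/seteqP; split=> [_ [y Vy <-]|_ [[y _ <-]]] /=.
  by split; [exists y|rewrite /= EK].
by rewrite EK => Vy; exists y.
Qed.

Let clEV : clopen (E @` V).
Proof. by rewrite imageEE; apply: clopenI => //; exact: preimage_clopen. Qed.

Let SE z : S z <-> (E @` V) z \/ range D z /\ S (T z).
Proof.
split=> [[[|n] [y [Vy ->]]]|[[y Vy <-]|[[y _ <-]]]].
- by left; exists y.
- by right; split; [exists (iter n D (E y))|rewrite /= DK; exists n, y].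
- by exists 0, y.
- by rewrite DK => -[n [y' [Vy' ->]]]; exists n.+1, y'.
Qed.

(** If some iterate of [T] takes [z] out of [range D], finitely many unfoldings of [SE] decide
    membership in [S] near [z] by clopen conditions; otherwise [fixD] applies. *)
Let near_S z : (\forall w \near z, S w <-> S z) \/ D z = z.
Proof.
have [|/existsNP[n]] := pselect (forall n, range D (iter n T z)).
  by move=> /fixD; right.
have near0 x : ~ range D x -> \forall w \near x, S w <-> S x.
  move=> nDx; apply: filterS2 (near_clopen x clEV) (near_clopen x clD) => w.
  by have := SE w; have := SE x; tauto.
move=> nD; left; elim: n z nD => [|n IH] z nD; first exact: near0.
have [Dz|] := pselect (range D z); last exact: near0.
have STz : nbhs z (T @^-1` [set w | S w <-> S (T z)]).
  by apply: cT; apply: IH; rewrite -iterSr.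
apply: filterS3 (near_clopen z clEV) (near_clopen z clD) STz => w + + /=.
by have := SE w; have := SE z; tauto.
Qed.

Let D_patch_continuous : continuous (patch id S D).
Proof.
move=> z; apply: patch_continuous_at; [exact: cD|exact: cvg_id|exact: near_S].
Qed.

(** Where [D z = z], cancelling gives [T z = z], so both pieces agree there too. *)
Let T_patch_continuous : continuous (patch id S T).
Proof.
move=> z; apply: patch_continuous_at; [exact: cT|exact: cvg_id|].
by have [|Dz] := near_S z; [left|right; rewrite -{1}Dz DK].
Qed.

(** Undoing [j] turns [U] without [V] into all of [Y]; shifting [S] by [D] vacates exactly the image
    of [V] under [E], and [V] moves in there. *)
Lemma hotel_homeomorphic (j q : Y -> Y) (U : set Y) :
    continuous j -> continuous q -> cancel j q -> clopen (range j) ->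
    V `&` range j = set0 -> V `|` range j = U ->
  homeomorphic (set_type U) Y.
Proof.
move=> cj cq jK clj VjI VjU.
pose g z := patch (patch id S D \o q) V E z.
pose h z := patch (j \o patch id S T) (E @` V) T z.
have hU z : U (h z).
  rewrite -VjU /h; have [[y Vy <-]|nEz] := pselect ((E @` V) z).
    by rewrite patch_in ?EK; [left|exists y].
  by rewrite patch_notin//=; right; eexists.
have SD z : S z -> S (D z).
  by move=> [n [y [Vy ->]]]; exists n.+1, y.
have hgK z : U z -> h (g z) = z.
  rewrite -VjU /g => Uz; have [Vz|nVz] := pselect (V z).
    by rewrite patch_in// /h patch_in ?EK//; exists z.
  case: Uz => // -[y _ yz]; rewrite patch_notin//= -yz jK.
  (* Neither case lands in the image of [V] under [E]: [D] avoids [range E], and that image lies in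
     [S]. *)
  have [Sy|nSy] := pselect (S y).
    rewrite patch_in// /h patch_notin; last by move=> [y' _ /esym/DE].
    by rewrite /= patch_in ?DK//; exact: SD.
  rewrite patch_notin// /h patch_notin; last by move=> Ey; apply: nSy; apply/SE; left.
  by rewrite /= patch_notin.
have njV y : ~ V (j y).
  by move=> Vj; have : (V `&` range j) (j y) by []; rewrite VjI.
have ghK z : g (h z) = z.
  rewrite /h; have [[y Vy <-]|nEz] := pselect ((E @` V) z).
    by rewrite patch_in; [rewrite EK /g patch_in|exists y].
  rewrite patch_notin// /g patch_notin//= jK.
  have [Sz|nSz] := pselect (S z); last by rewrite !patch_notin.
  have [//|[[y _ yz] STz]] := (SE z).1 Sz.
  by rewrite (patch_in _ S T)// patch_in// -yz DK.
exists (g \o set_val), (fun z => SigSub (mem_set (hU z))); split.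
- by move=> z; apply: val_inj; rewrite /= hgK//; exact: set_valP.
- by move=> z; rewrite /= ghK.
- move=> z; apply: continuous_comp; first exact: initial_continuous.
  apply: patch_continuous => // y.
  by apply: continuous_comp; [exact: cq|exact: D_patch_continuous].
- apply: continuous_comp_initial.
  apply: patch_continuous => // y.
  by apply: continuous_comp; [exact: T_patch_continuous|exact: cj].
Qed.

End hotel.

(** * Powers of a space and their boxes *)

Section product.
Context {I : choiceType} {X : topologicalType}.
Local Notation Y := (prod_topology (fun _ : I => X)).

Lemma prod_eval_continuous (k : I) : continuous (fun z : Y => z k).
Proof. exact: (@proj_continuous I (fun=> X) k). Qed.

Lemma prod_continuous {T : topologicalType} (f : T -> Y) :
  (forall k, continuous (fun z => f z k)) -> continuous f.
Proof.
move=> cf z; apply/cvg_sup => k.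
exact: (@continuous_comp_initial Y T X (fun z => z k) f (cf k) z).
Qed.

Lemma prod_nbhs_box (z : Y) (U : set Y) : nbhs z U ->
  exists (l : seq I) (N : I -> set X), (forall k, nbhs (z k) (N k)) /\
    [set y : Y | forall k, k \in l -> N k (y k)] `<=` U.
Proof.
(* The sets containing a box around [z] form a filter, and [cvg_sup] reduces its
   convergence to [z] to one coordinate at a time. *)
pose G : set_system Y := [set U | exists (l : seq I) (N : I -> set X),
  (forall k, nbhs (z k) (N k)) /\
    [set y : Y | forall k, k \in l -> N k (y k)] `<=` U].
have FG : Filter G.
  split.
  - by exists [::], (fun=> setT); split=> // k; exact: filterT.
  - move=> A B [l [N [zN NA]]] [l' [N' [zN' NB]]].
    exists (l ++ l'), (fun k => N k `&` N' k); split=> [k|y yN].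
      exact: filterI.
    by split; [apply: NA|apply: NB] => k kl; apply yN; rewrite mem_cat kl ?orbT.
  - by move=> A B AB [l [N [zN NA]]]; exists l, N; split=> // y /NA /AB.
suff: G --> z by apply.
apply/cvg_sup => k A [B [[W oW <-] Wz WA]].
exists [:: k], (fun k' => if k' == k then W else setT); split=> [k'|y yW].
  by case: eqP => [->|_]; [exact: open_nbhs_nbhs|exact: filterT].
by apply: WA; have := yW k (mem_head _ _); rewrite eqxx.
Qed.

(** When [r] maps the complement of [l] bijectively onto [I], this embeds the power onto a box. A
    single coordinate and a constant [p] give the maps [D] and [E]. *)
Definition extend (l : seq I) (r : I -> I) (p : I -> X) (y : Y) : Y :=
  fun k => if k \in l then p k else y (r k).

Lemma reindex_continuous (s : I -> I) : continuous (fun z : Y => (z \o s) : Y).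
Proof. by apply: prod_continuous => k; exact: prod_eval_continuous. Qed.

Lemma extend_continuous l r p : continuous (extend l r p).
Proof.
apply: prod_continuous => k; rewrite /extend; case: (k \in l).
  exact: cst_continuous.
exact: prod_eval_continuous.
Qed.

Lemma clopen_box (l : seq I) (p : I -> X) :
  (forall k, k \in l -> clopen [set p k]) ->
  clopen [set z : Y | forall k, k \in l -> z k = p k].
Proof.
elim: l => [|a l IH] pl.
  by rewrite (_ : mkset _ = setT); [exact: clopenT|apply/seteqP; split].
have -> : [set z : Y | forall k, k \in a :: l -> z k = p k] =
    (fun z : Y => z a) @^-1` [set p a] `&`
    [set z : Y | forall k, k \in l -> z k = p k].
  apply/seteqP; split=> [z zp|z [/= za zl] k].
    by split=> [|k kl]; apply: zp; rewrite inE ?eqxx ?kl ?orbT.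
  by rewrite inE => /predU1P[->|/zl].
apply: clopenI; last by apply: IH => k kl; apply: pl; rewrite inE kl orbT.
apply: preimage_clopen; last exact: prod_eval_continuous.
by apply: pl; rewrite mem_head.
Qed.

Section shift.
Context {l : seq I} {s r : I -> I}.
Hypotheses (sK : cancel s r) (sl : forall k, s k \notin l).
Hypothesis rK : forall k, k \notin l -> s (r k) = k.
Context (p : I -> X).

(** Reindexing along [s] never reads a coordinate in [l], so one left inverse serves every [p]: this
    is the common [T] of [D] and [E]. *)
Lemma extendK : cancel (extend l r p) (fun z : Y => (z \o s) : Y).
Proof. by move=> y; apply/funext => k; rewrite /= /extend (negbTE (sl k)) sK. Qed.

Lemma range_extend :
  range (extend l r p) = [set z : Y | forall k, k \in l -> z k = p k].
Proof.
apply/seteqP; split=> [_ [y _ <-] k kl|z zp]; first by rewrite /extend kl.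
exists (z \o s) => //; apply/funext => k; rewrite /extend.
by case: (boolP (k \in l)) => [/zp|/rK /= ->].
Qed.
End shift.

End product.

(** * Injective shifts of an infinite index set *)

(** [s] advances an injective sequence starting at [a] and fixes all other indices. The last clause
    serves to find the fixed points of [D]. *)
Lemma exists_shift1 {I : choiceType} (a : I) : infinite_set [set: I] ->
  exists s r : I -> I, [/\ cancel s r, forall k, s k \notin [:: a],
    forall k, k \notin [:: a] -> s (r k) = k
    & forall k, s k = k \/ exists n, k = iter n s a].
Proof.
move=> infI.
have [i i_inj ia] : exists2 i : nat -> I, injective i & i 0 = a.
  pose J : pointedType := HB.pack I (isPointed.Build I a).
  (* [f] injects [nat] into the complement of [a]; then [a] is prepended. *)
  have /infiniteP/(@ppcard_leP _ J)[f] := infinite_setD infI (finite_set1 a).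
  have fa n : f n <> a by have [] := @funS _ _ _ _ f n Logic.I.
  exists (fun n => if n is n'.+1 then f n' else a) => //.
  move=> [|m] [|n] // => [/esym/fa //|/fa //|/inj fmn].
  by rewrite fmn ?inE.
pose ofi k : option nat :=
  if pselect (exists n, i n = k) is left ik then Some (projT1 (cid ik)) else None.
have iK n : ofi (i n) = Some n.
  rewrite /ofi; case: pselect => [ik|[]]; last by exists n.
  by congr Some; apply: i_inj; exact: projT2 (cid ik).
have ofiP k : ofi k = None \/ exists n, k = i n.
  rewrite /ofi; case: pselect => [ik|]; last by left.
  by right; have [n <-] := ik; exists n.
pose s k := if ofi k is Some n then i n.+1 else k.
(* Since [0.-1] is [0], [r] fixes [a]. *)
pose r k := if ofi k is Some n then i n.-1 else k.
have iterE n : i n = iter n s a.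
  by elim: n => //= n <-; rewrite /s iK.
exists s, r; split=> k.
- have [ki|[n ->]] := ofiP k; first by rewrite /s ki /r ki.
  by rewrite /s iK /r iK.
- rewrite inE /s -ia; have [ki|[n ->]] := ofiP k.
    by rewrite ki; apply/eqP => k0; rewrite k0 iK in ki.
  by rewrite iK; apply/eqP => /i_inj.
- rewrite inE /s /r; have [ki|[[|n] ->]] := ofiP k; first by rewrite ki ki.
    by rewrite ia eqxx.
  by rewrite iK iK.
- have [ki|[n ->]] := ofiP k; first by left; rewrite /s ki.
  by right; exists n.
Qed.

Lemma exists_shift {I : choiceType} (l : seq I) : infinite_set [set: I] ->
  exists s r : I -> I, [/\ cancel s r, forall k, s k \notin l
    & forall k, k \notin l -> s (r k) = k].
Proof.
move=> infI; elim: l => [|a l [s [r [sK sl rK]]]]; first by exists id, id.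
have [al|nal] := boolP (a \in l).
  exists s, r; split=> // k; rewrite inE; last by rewrite negb_or => /andP[_ /rK].
  by rewrite negb_or sl andbT; apply: contraNneq (sl k) => ->.
(* [s] takes the value [a] only at [r a], so precomposing it with a shift that avoids [r a] makes it
   avoid [a]. *)
have [s1 [r1 [s1K s1a r1K _]]] := exists_shift1 (r a) infI.
exists (s \o s1), (r1 \o r); split=> [k|k|k].
- by rewrite /= sK s1K.
- rewrite inE negb_or sl andbT; apply: contraNneq (s1a k) => <-.
  by rewrite sK mem_head.
- rewrite inE negb_or => /andP[ka kl] /=; rewrite r1K ?rK// inE.
  by apply: contra_neq ka => rka; rewrite -(rK k kl) rka rK.
Qed.

(** * Isolated points *)

Lemma clopen_isolated {X : topologicalType} (x : X) :
  accessible_space X -> isolated [set: X] x -> clopen [set x].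
Proof.
move=> aX [_ [V xV]]; rewrite setIT => Vx; split.
  by rewrite openE => _ ->; rewrite /interior -Vx.
exact: accessible_closed_set1.
Qed.

(** The complement of the only isolated point is open; were it non-empty, density would put another
    isolated point in it. *)
Lemma dense_isolated_eq {X : topologicalType} (x y : X) :
    accessible_space X -> dense (isolated [set: X]) ->
    (forall d e, isolated [set: X] d -> isolated [set: X] e -> d = e) ->
  x = y.
Proof.
move=> aX dX iso_eq.
have [d [_ isod]] := dX setT (ex_intro _ x Logic.I) openT.
suff eqd z : z = d by rewrite (eqd x) (eqd y).
apply: contrapT => zd.
have oCd : open (~` [set d]) by apply: closed_openC; exact: accessible_closed_set1.
by have [e [ed isoe]] := dX _ (ex_intro _ z zd) oCd; apply: ed; exact: iso_eq.
Qed.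

Lemma prod_dense_isolated_box {I : choiceType} {X : topologicalType}
    (U : set (prod_topology (fun _ : I => X))) :
    dense (isolated [set: X]) -> open U -> U !=set0 ->
  exists (l : seq I) (p : I -> X), (forall k, isolated [set: X] (p k)) /\
    [set z | forall k, k \in l -> z k = p k] `<=` U.
Proof.
move=> dX oU [z Uz].
have [l [N [zN NU]]] := prod_nbhs_box z U (open_nbhs_nbhs (conj oU Uz)).
have /choice[p pN] k : exists x, isolated [set: X] x /\ N k x.
  have [x [Nx isox]] := dX _ (ex_intro _ (z k) (zN k)) (open_interior (N k)).
  by exists x; split=> //; exact: interior_subset.
exists l, p; split=> [k|y yp]; first exact: (pN k).1.
by apply: NU => k kl; rewrite yp//; exact: (pN k).2.
Qed.

(** * Clopen subsets of a power *)

Lemma clopen_homeomorphic_power {I : choiceType} {X : topologicalType} (d e : X)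
    (U : set (prod_topology (fun _ : I => X))) :
    infinite_set [set: I] -> accessible_space X ->
    dense (isolated [set: X]) ->
    isolated [set: X] d -> isolated [set: X] e -> d <> e ->
    clopen U -> U !=set0 ->
  homeomorphic (set_type U) (prod_topology (fun _ : I => X)).
Proof.
move=> infI aX dX isod isoe de clU U0.
have [l [p [isop pU]]] := prod_dense_isolated_box U dX clU.1 U0.
have [s [r [sK sl rK]]] := exists_shift l infI.
have [a _] := infinite_setN0 infI.
have [s1 [r1 [s1K s1a r1K s1iter]]] := exists_shift1 a infI.
have clj : clopen (range (extend (X := X) l r p)).
  by rewrite (range_extend rK); apply: clopen_box => k _; exact: clopen_isolated.
have clx x : isolated [set: X] x ->
    clopen (range (extend (X := X) [:: a] r1 (cst x))).
  move=> isox; rewrite (range_extend r1K); apply: clopen_box => k _.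
  exact: clopen_isolated.
have jU : range (extend (X := X) l r p) `<=` U by rewrite (range_extend rK).
have clV : clopen (U `\` range (extend (X := X) l r p)).
  by rewrite setDE; apply: clopenI => //; apply: clopenC.
apply: (hotel_homeomorphic _ _ _ (extend_continuous [:: a] r1 (cst d))
  (extend_continuous [:: a] r1 (cst e)) (reindex_continuous s1)
  (extendK s1K s1a _) (extendK s1K s1a _) (clx d isod) (clx e isoe) _ _ _ clV
  _ _ _ (extend_continuous l r p) (reindex_continuous s) (extendK sK sl p) clj).
(* The two ranges differ at coordinate [a], which is [d] in one and [e] in the other. *)
- by move=> y y' /(congr1 (@^~ a)); rewrite /extend mem_head.
(* Applying [T] [n] times brings coordinate [iter n s1 a] to [a], so [z] equals [d] along the whole
   orbit of [a]. Prepending [d] changes nothing there, and [s1] fixes the other indices. *)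
- move=> z; rewrite (range_extend r1K) => zd.
  have {}zd n : z (iter n s1 a) = d.
    rewrite -[RHS](zd n a (mem_head _ _)).
    by elim: n z {zd} => // n IH z; rewrite [in RHS]iterSr -IH.
  apply/funext => k; rewrite /extend; case: ifPn => [|kNa].
    by rewrite inE => /eqP ->; rewrite -(zd 0).
  have [sk|[n kn]] := s1iter (r1 k); first by rewrite -[in RHS](r1K k kNa) sk.
  by rewrite -[in RHS](r1K k kNa) kn zd -iterS zd.
- by rewrite setDE -setIA setICl setI0.
- by rewrite setDE setUIl setUCl setIT; apply/setUidPl.
Qed.

Theorem theorem18 (X : topologicalType) (tX : tychonoff_space X)
    (dX : dense (isolated [set: X]))
    (kappa : Type) (kappa_inf : infinite_set [set: kappa]) :
  h_homogeneous (prod_topology (fun _ : kappa => X)).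
Proof.
have [aX _] := tX.
move=> U V clU clV U0 V0.
have [[d [e [isod isoe de]]]|noiso] := pselect (exists d e,
  [/\ isolated [set: X] d, isolated [set: X] e & d <> e]).
  have power (W : set (prod_topology (fun _ : kappa => X))) :
      clopen W -> W !=set0 ->
      homeomorphic (set_type W) (prod_topology (fun _ : kappa => X)).
    exact: (@clopen_homeomorphic_power {classic kappa} X d e W).
  exact: homeomorphic_trans (power U clU U0)
    (homeomorphic_sym _ _ (power V clV V0)).
have eqX (x y : X) : x = y.
  apply: dense_isolated_eq => // d e isod isoe.
  by apply: contrapT => de; apply: noiso; exists d, e.
have full (W : set (prod_topology (fun _ : kappa => X))) : W !=set0 -> W = setT.
  move=> [w Ww]; apply/seteqP; split=> // z _.
  by rewrite (_ : z = w)//; apply/funext.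
rewrite (full U U0) (full V V0).
by exists id, id; split=> // x; exact: cvg_id.
Qed.
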